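(* Let $m,n,r$ be positive integers with $\gcd(m,n)=\gcd(m,r-1)=1$ and $r^n\equiv 1 \pmod m$, let $$\mathrm{ZM}(m,n,r)=\langle a,b \mid a^m=b^n=1,\ b^{-1}ab=a^r\rangle,$$ and let $d=\min\{k\in\mathbb{N},\,k\geq 1 \mid r^k\equiv 1 \pmod m\}$ be the multiplicative order of $r$ modulo $m$. Then $$m(\mathrm{ZM}(m,n,r))=\frac{m^2n^2}{d^2}.$$ Moreover, the Chermak-Delgado lattice $\mathcal{CD}(\mathrm{ZM}(m,n,r))$ is a chain of length $0$, namely $$\mathcal{CD}(\mathrm{ZM}(m,n,r))=\{H_{(1,d,0)}\},\qquad \text{where } H_{(1,d,0)}=\langle a,b^d\rangle.$$
   Context: For a finite group $G$ and a subgroup $H\leq G$, the Chermak-Delgado measure of $H$ is $m_G(H)=|H|\,|C_G(H)|$, where $C_G(H)$ is the centralizer of $H$ in $G$. Set $m(G)=\max\{m_G(H)\mid H\leq G\}$ and $\mathcal{CD}(G)=\{H\leq G\mid m_G(H)=m(G)\}$; this set is a sublattice of the subgroup lattice of $G$, called the Chermak-Delgado lattice of $G$. A chain of length $0$ is a lattice with exactly one element. The group $\mathrm{ZM}(m,n,r)$ has order $mn$. Conventions: the multiplicative order of any integer modulo $1$ is $1$, and $\gcd(m,0)=m$. *)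

(* Defs.v *)
From mathcomp Require Import all_boot all_order all_fingroup all_algebra all_solvable.

Set Implicit Arguments.
Unset Strict Implicit.
Unset Printing Implicit Defensive.

Local Open Scope group_scope.

Definition cd_measure (gT : finGroupType) (G H : {group gT}) : nat :=
  (#|H| * #|'C_G(H)|)%N.

Definition cd_max (gT : finGroupType) (G : {group gT}) : nat :=
  (\max_(H : {group gT} | H \subset G) cd_measure G H)%N.

Definition cd_lattice (gT : finGroupType) (G : {group gT}) : {set {group gT}} :=
  [set H : {group gT} | (H \subset G) && (cd_measure G H == cd_max G)].

Definition chain_of_length (gT : finGroupType) (k : nat) (L : {set {group gT}}) :
    Prop :=
  #|L| = k.+1
  /\ (forall H K : {group gT}, H \in L -> K \in L -> H \subset K \/ K \subset H).

Definition is_mult_order (m r d : nat) : Prop :=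
  [/\ (0 < d)%N, (r ^ d = 1 %[mod m])%N
    & forall k, (0 < k)%N -> (r ^ k = 1 %[mod m])%N -> (d <= k)%N].

(* [Grp] asserts universality among finite groups only; this pins down the
   presented group because the relations a^m = b^n = 1, b^-1ab = a^r (m, n > 0)
   make every element equal to some b^j a^i with i < m and j < n. A generating pair
   satisfying the relations of a finite presented group is the image of the
   standard pair under an isomorphism, so a and b are the generators of the
   presentation up to isomorphism. *)
Definition is_ZM (gT : finGroupType) (G : {group gT}) (a b : gT) (m n r : nat) :
    Prop :=
  [/\ G :=: <<[set a; b]>>,
      [/\ a ^+ m = 1, b ^+ n = 1 & b^-1 * a * b = a ^+ r]
    & G \isog Grp (x : y : x ^+ m = y ^+ n = 1, y^-1 * x * y = x ^+ r)].

Lemma is_ZM_exists (m n r : nat) :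
    (0 < m)%N -> (0 < n)%N -> coprime m (r - 1) -> (r ^ n = 1 %[mod m])%N ->
  exists (gT : finGroupType) (G : {group gT}) (a b : gT),
    is_ZM G a b m n r /\ #|G| = (m * n)%N.
Proof.
move=> m_gt0 n_gt0 co_mr rn1.
suff [gT [G [oG isoG]]] : exists (gT : finGroupType) (G : {group gT}),
    #|G| = (m * n)%N
    /\ G \isog Grp (x : y : x ^+ m = y ^+ n = 1, y^-1 * x * y = x ^+ r).
  have /existsP[[a b] /eqP[defG am bn ab]] := isoGrp_hom isoG.
  exists gT, G, a, b; do 2!split=> //.
  by rewrite -defG joing_idl joing_idr.
have [m1 | m_neq1] := eqVneq m 1%N.
  have [gT [y oy]] : exists (gT : finGroupType) (y : gT), #[y] = n.
    case: n n_gt0 {rn1} => [//|[|n]] _; first by exists 'Z_2, 1; rewrite order1.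
    by exists 'Z_n.+2, Zp1; rewrite order_Zp1.
  exists gT, <[y]>%G; rewrite m1 mul1n; split; first exact: oy.
  apply: intro_isoGrp => [|rT H].
    apply/existsP; exists (1, y); rewrite /= !xpair_eqE cycle1 joing1G eqxx.
    by rewrite expg1 -oy expg_order !eqxx mulg1 mulVg expg1n eqxx.
  case/existsP=> -[u v] /= /eqP[<- u1 vn _].
  rewrite expg1 in u1; rewrite u1 cycle1 joing1G.
  have dv : #[v] %| #[y] by rewrite oy order_dvdn vn.
  apply/homgP; exists (eltm_morphism dv).
  by rewrite /= morphim_cycle ?cycle_id //= eltm_id.
have m_gt1 : (1 < m)%N by rewrite ltn_neqAle eq_sym m_neq1.
have n_gt1 : (1 < n)%N.
  rewrite ltnNge; apply/negP=> n_le1; case/negP: m_neq1.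
  have n1 : n = 1%N by apply/eqP; rewrite eqn_leq n_le1.
  have [r0 | r_gt0] := posnP r.
    by rewrite -dvdn1 -(gcdn0 m) -[X in _ %| X](eqP co_mr) r0.
  move/eqP: rn1; rewrite n1 expn1 eqn_mod_dvd // => /gcdn_idPl mr.
  by rewrite -mr (eqP co_mr).
have co_rm : coprime m r.
  rewrite coprime_sym -(coprime_pexpl _ _ n_gt0) -coprime_modl rn1 coprime_modl.
  exact: coprime1n.
pose w : 'Z_m := Zp1.
have ow : #[w] = m by rewrite order_Zp1 Zp_cast.
have sEx : exists s, [/\ s \in Aut <[w]>, #[s] %| n & s w = w ^+ r].
  have ru : (r%:R : 'Z_#[w])%R \is a GRing.unit by rewrite unitZpE ow.
  pose u := FinRing.unit 'Z_#[w] ru.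
  have un : u ^+ n = 1.
    apply: val_inj; rewrite FinRing.val_unitX /= -GRing.natrX; apply: val_inj => /=.
    by rewrite !val_Zp_nat ?ow // rn1 modn_small.
  have uU : u \in units_Zp #[w] by rewrite inE.
  exists (Zp_unitm u); split; first exact: Aut_aut.
    by rewrite order_dvdn -morphX // un morph1.
  rewrite autE ?cycle_id //=; apply/eqP; rewrite eq_expg_mod_order.
  by rewrite val_Zp_nat ow // modn_mod.
exists (Extremal.gtype m n r), [set: Extremal.gtype m n r]%G; split.
  by rewrite (Extremal.card r n_gt1 m_gt1) mulnC.
have isoE := Extremal.Grp n_gt1 m_gt1 sEx.
move=> rT H; rewrite (isoE rT H).
apply/existsP/existsP=> -[[u v] /= /eqP[dH um vn uv]]; exists (u, v).
  by rewrite /= dH um vn !xpair_eqE !eqxx -uv conjgE mulgA eqxx.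
by rewrite /= dH um vn !xpair_eqE !eqxx -uv conjgE mulgA eqxx.
Qed.

(* Main.v *)
Require Import Defs.
From mathcomp Require Import all_boot all_fingroup ssralg rat.
From mathcomp Require Import ssrnum all_solvable.

(* Let A = <a>, a cyclic normal Hall subgroup of G with abelian centralizer. For
   X <= A, the orbit of a under C_G(X) lies in the coset of a by the subgroup of
   order |A : X| of A, because c centralizing X gives (a^-1 a^c)^|A : X| = 1. Hence
   |C_G(X) : C_G(A)| <= |A : X|, that is |X| |C_G(X)| <= |A| |C_G(A)|; equality
   forces X = A since the first index is coprime to |A| and the second divides it.
   For H <= G and K = C_G(H), the subgroup HA centralizes K :&: A, and KA
   centralizes H :&: A; so |H| |A| <= |H :&: A| |C_G(K :&: A)| and symmetrically.
   Multiplying, |H| |K| <= |C_G(A)|^2, with equality only if A <= H and A <= K,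
   whence H = C_G(A). In ZM(m, n, r), C_G(a) = <a, b^d> has order m n / d. *)

Section ChermakDelgado.

Set Implicit Arguments.
Unset Strict Implicit.

Local Open Scope group_scope.

Lemma leqif_card_mul_cent (gT : finGroupType) (G A X : {group gT}) :
    A <| G -> cyclic A -> coprime #|A| #|G : A| -> X \subset A ->
  (#|X| * #|'C_G(X)| <= #|A| * #|'C_G(A)| ?= iff (X == A))%N.
Proof.
case/andP=> sAG nAG /cyclicP[a defA] coA sXA.
set s := #|A : X|.
have cardA : #|A| = (#|X| * s)%N by rewrite Lagrange.
have oa : #[a] = (#|X| * s)%N by rewrite -cardA defA.
have sAC : A \subset 'C_G(A) by rewrite subsetI sAG defA -abelianE cycle_abelian.
have sCC : 'C_G(A) \subset 'C_G(X) by rewrite setIS // centS.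
set k := #|'C_G(X) : 'C_G(A)|.
have cardC : #|'C_G(X)| = (#|'C_G(A)| * k)%N by rewrite Lagrange.
have orbE : #|orbit 'J 'C_G(X) a| = k.
  rewrite card_orbit astab1J /k -cent_cycle -defA -setIA.
  by rewrite (setIidPr (centS sXA)).
have k_le_s : (k <= s)%N.
  have os : #|<[a ^+ #|X|]>| = s.
    by rewrite -orderE orderXdiv oa ?dvdn_mulr // mulKn.
  rewrite -orbE -os -(card_lcoset <[_]> a); apply/subset_leq_card.
  apply/subsetP=> _ /orbitP[c /setIP[Gc cXc] <-].
  have aA : a \in A by rewrite defA cycle_id.
  (* A cyclic group has one subgroup of each order, and [a ^+ s] has order [#|X|]. *)
  have asX : a ^+ s \in X.
    have sA : a ^+ s \in A by rewrite groupX.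
    have cycA : cyclic A by apply/cyclicP; exists a.
    rewrite -cycle_subG -(cardSg_cyclic cycA) ?cycle_subG // -orderE.
    by rewrite orderXdiv oa ?dvdn_mull // mulnK // indexg_gt0.
  have : a^-1 * a ^ c \in A.
    by rewrite groupM ?groupV // memJ_norm // (subsetP nAG).
  rewrite mem_lcoset {1}defA => /cycleP[i def_ac].
  (* Both factors lie in the abelian group [<[a]>], so the power distributes; [c] fixes [a ^+ s],
     which lies in [X]. *)
  have : (a^-1 * a ^ c) ^+ s = 1.
    rewrite expgMn; last first.
      apply: (centsP (cycle_abelian a)); rewrite -defA ?groupV //.
      by rewrite memJ_norm // (subsetP nAG).
    by rewrite -conjXg conjgE -(centP cXc) // mulKg expgVn mulVg.
  move/eqP; rewrite def_ac -expgM -order_dvdn oa dvdn_pmul2r ?indexg_gt0 //.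
  by case/dvdnP=> j ->; rewrite mulnC expgM mem_cycle.
(* In the tower [A], ['C_G(A)], ['C_G(X)], [G], the middle index [k] divides [#|G : A|]. *)
have co_ks : coprime k s.
  apply: (@coprime_dvdr _ #|A|); first by rewrite cardA dvdn_mull.
  rewrite coprime_sym; apply: coprime_dvdr coA.
  rewrite -(Lagrange_index (subsetIl G 'C(X)) (subset_trans sAC sCC)).
  by rewrite -(Lagrange_index sCC sAC) mulnA dvdn_mulr // dvdn_mull.
have -> : (#|X| * #|'C_G(X)| = #|X| * #|'C_G(A)| * k)%N by rewrite cardC mulnA.
have -> : (#|A| * #|'C_G(A)| = #|X| * #|'C_G(A)| * s)%N by rewrite cardA mulnAC.
split; first by rewrite leq_mul2l k_le_s orbT.
rewrite eqn_pmul2l ?muln_gt0 ?cardG_gt0 //; apply/eqP/eqP => [eq_ks | eqXA].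
  apply/val_inj/eqP; rewrite eqEsubset sXA -indexg_eq1 -/s.
  by move: co_ks; rewrite eq_ks /coprime gcdnn.
by rewrite /k /s -eqXA !indexgg.
Qed.

Lemma leqif_cd_measure (gT : finGroupType) (G A H : {group gT}) :
    A <| G -> cyclic A -> coprime #|A| #|G : A| -> abelian 'C_G(A) ->
    H \subset G ->
  (cd_measure G H <= #|'C_G(A)| ^ 2 ?= iff (H == 'C_G(A) :> {set gT}))%N.
Proof.
move=> nsAG cycA coA abC sHG; have [sAG nAG] := andP nsAG.
pose K := 'C_G(H)%G.
(* The product set [L * A] lies in ['C_G(Y)], because [A] is abelian and contains [Y]. *)
have leL (L Y : {group gT}) : L \subset G -> L \subset 'C(Y) -> Y \subset A ->
    (#|L| * #|A| <= #|L :&: A| * #|'C_G(Y)|)%N.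
  move=> sLG cYL sYA; rewrite mul_cardG mulnC leq_mul2l subset_leq_card ?orbT //.
  rewrite mul_subG // subsetI ?sLG ?sAG //=.
  exact: subset_trans (cyclic_abelian cycA) (centS sYA).
have cKH : H \subset 'C(K) by rewrite centsC subsetIr.
have sKG : K \subset G by apply: subsetIl.
have cHK : K \subset 'C(H) by apply: subsetIr.
have leH := leL H (K :&: A)%G sHG
  (subset_trans cKH (centS (subsetIl K A))) (subsetIr K A).
have leK := leL K (H :&: A)%G sKG
  (subset_trans cHK (centS (subsetIl H A))) (subsetIr H A).
have leifH : (_ <= _ ?= iff (H :&: A == A)%G)%N :=
  leqif_card_mul_cent nsAG cycA coA (subsetIr H A).
have leifK : (_ <= _ ?= iff (K :&: A == A)%G)%N :=
  leqif_card_mul_cent nsAG cycA coA (subsetIr K A).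
have A_gt0 := cardG_gt0 A; have C_gt0 := cardG_gt0 'C_G(A).
(* The equality case of a product of bounds also allows a zero bound, which positivity excludes
   here. *)
have := leqif_mul leifH leifK; rewrite gtn_eqF ?muln_gt0 ?A_gt0 ?C_gt0 //=.
set P := (X in (X <= _ ?= iff _)%N) => leifP.
have P_le : (P <= #|A| ^ 2 * #|'C_G(A)| ^ 2)%N by rewrite -expnMn -mulnn leifP.
(* [leH] and [leK] pair each intersection with the centralizer of the other one; only their product
   can be regrouped into [P]. *)
have leP : (#|A| ^ 2 * cd_measure G H <= P)%N.
  rewrite /cd_measure -mulnn mulnC mulnACA (leq_trans (leq_mul leH leK)) //.
  by rewrite mulnACA [X in (_ * X <= _)%N]mulnC mulnACA.
have le_m : (cd_measure G H <= #|'C_G(A)| ^ 2)%N.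
  rewrite -(@leq_pmul2l (#|A| ^ 2)) ?expn_gt0 ?A_gt0 //.
  exact: leq_trans leP P_le.
split=> //; apply/eqP/eqP=> [eq_m | defH].
  have : P == (#|A| * #|'C_G(A)| * (#|A| * #|'C_G(A)|))%N.
    by rewrite eqn_leq mulnn expnMn P_le -eq_m.
  rewrite leifP => /andP[/eqP/(congr1 val)/= /setIidPr sAH].
  move=> /eqP/(congr1 val)/= /setIidPr sAK.
  have sHC : H \subset 'C_G(A).
    by rewrite subsetI sHG (subset_trans cKH (centS sAK)).
  have sKC : K \subset 'C_G(A).
    by rewrite subsetI sKG (subset_trans cHK (centS sAH)).
  (* With [C] for ['C_G(A)]: [#|C| ^ 2 = #|H| * #|K| <= #|H| * #|C|], so [#|C| <= #|H|]. *)
  apply/eqP; rewrite eqEcard sHC -(leq_pmul2r C_gt0) mulnn -eq_m.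
  by rewrite leq_mul2l subset_leq_card ?orbT.
(* Conversely, ['C_G(A)] is its own centralizer in [G]: it is abelian and contains [A]. *)
have defK : K = 'C_G(A) :> {set gT}.
  have sAH : A \subset H by rewrite defH subsetI sAG; apply: cyclic_abelian.
  apply/eqP; rewrite eqEsubset /= setIS ?centS //=.
  by rewrite subsetI subsetIl defH; apply: abC.
by rewrite /cd_measure defK defH mulnn.
Qed.

Lemma cd_max_cyclic_Hall (gT : finGroupType) (G A : {group gT}) :
    A <| G -> cyclic A -> coprime #|A| #|G : A| -> abelian 'C_G(A) ->
  cd_max G = (#|'C_G(A)| ^ 2)%N.
Proof.
move=> nsAG cycA coA abC; apply/eqP; rewrite eqn_leq; apply/andP; split.
  by apply/bigmax_leqP=> H sHG; rewrite leqif_cd_measure.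
have sCG : 'C_G(A) \subset G := subsetIl _ _.
apply: (bigmax_sup 'C_G(A)%G) => //.
by rewrite eq_leq //; apply/esym/eqP; rewrite (leqif_cd_measure nsAG).
Qed.

Lemma cd_lattice_cyclic_Hall (gT : finGroupType) (G A : {group gT}) :
    A <| G -> cyclic A -> coprime #|A| #|G : A| -> abelian 'C_G(A) ->
  cd_lattice G = [set 'C_G(A)%G].
Proof.
move=> nsAG cycA coA abC; apply/setP=> H; rewrite !inE.
rewrite (cd_max_cyclic_Hall nsAG) // -val_eqE /=.
have [sHG | nsHG] /= := boolP (H \subset G).
  by rewrite (leqif_cd_measure nsAG).
by apply/esym/negP=> /eqP defH; rewrite defH subsetIl in nsHG.
Qed.

(** Groups with the same presentation are homomorphic images of each other, so [G] has the order of
    the model given by [is_ZM_exists]. *)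
Lemma card_ZM (gT : finGroupType) (G : {group gT}) (a b : gT) (m n r : nat) :
    (0 < m)%N -> (0 < n)%N -> coprime m (r - 1) -> (r ^ n = 1 %[mod m])%N ->
  is_ZM G a b m n r -> #|G| = (m * n)%N.
Proof.
move=> m_gt0 n_gt0 co_mr r_n [_ _ isoG].
have [rT [H [u [v [[_ _ isoH] <-]]]]] := is_ZM_exists m_gt0 n_gt0 co_mr r_n.
have homHG : H \homg G by rewrite (isoG _ H) isoGrp_hom.
have homGH : G \homg H by rewrite (isoH _ G) isoGrp_hom.
by apply/eqP; rewrite eqn_leq !leq_homg.
Qed.

Lemma mult_order_dvd (m r d k : nat) :
  is_mult_order m r d -> (r ^ k == 1 %[mod m])%N = (d %| k)%N.
Proof.
case=> d_gt0 rd min_d.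
have rqd q : (r ^ (q * d) = 1 %[mod m])%N.
  by rewrite mulnC expnM -modnXm rd modnXm exp1n.
apply/eqP/idP=> [rk | /dvdnP[q ->] //].
have rk' : (r ^ (k %% d) = 1 %[mod m])%N.
  by rewrite -rk {2}(divn_eq k d) expnD -modnMml rqd modnMml mul1n.
rewrite /dvdn; have [//|kd_gt0] := posnP (k %% d).
by have := min_d _ kd_gt0 rk'; rewrite leqNgt ltn_pmod.
Qed.

(** Provides what the general results require of [A = <[a]>], and identifies its centralizer. *)
Lemma ZM_structure (gT : finGroupType) (G : {group gT}) (a b : gT) (m n r d : nat) :
    (0 < m)%N -> (0 < n)%N -> coprime m n -> coprime m (r - 1) ->
    (r ^ n = 1 %[mod m])%N -> is_mult_order m r d -> is_ZM G a b m n r ->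
  [/\ <[a]> <| G, coprime #[a] #|G : <[a]>|,
      'C_G(<[a]>) = <<[set a; b ^+ d]>>, abelian 'C_G(<[a]>)
    & #|'C_G(<[a]>)| = (m * (n %/ d))%N].
Proof.
move=> m_gt0 n_gt0 co_mn co_mr r_n d_order G_ZM.
have oG := card_ZM m_gt0 n_gt0 co_mr r_n G_ZM.
case: G_ZM => defG [am bn ab] _.
have ajb : a ^ b = a ^+ r by rewrite conjgE mulgA.
have ajbk k : a ^ (b ^+ k) = a ^+ (r ^ k).
  elim: k => [|k IHk]; first by rewrite conjg1 expn0 expg1.
  by rewrite expgSr conjgM IHk conjXg ajb -expgM expnS mulnC.
have nab : <[b]> \subset 'N(<[a]>).
  rewrite cycle_subG; apply/normP/eqP.
  by rewrite eqEcard cardJg leqnn andbT -cycleJ ajb cycleX.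
have mulAB : <[a]> * <[b]> = G.
  by rewrite defG -norm_joinEr // joing_idl joing_idr.
have dv_a : #[a] %| m by rewrite order_dvdn am.
have dv_b : #[b] %| n by rewrite order_dvdn bn.
have co_ab : coprime #[a] #[b].
  exact: coprime_dvdl dv_a (coprime_dvdr dv_b co_mn).
have oab : (#[a] * #[b] = m * n)%N.
  by rewrite -oG -mulAB coprime_cardMg.
(* The orders of [a] and [b] divide [m] and [n], and their product is [m * n], so neither can be
   smaller. *)
have oa : #[a] = m.
  apply/eqP; rewrite eqn_leq dvdn_leq //= -(leq_pmul2r n_gt0) -oab.
  by rewrite leq_mul2l dvdn_leq ?orbT.
have ob : #[b] = n by apply/eqP; rewrite -(eqn_pmul2l m_gt0) -oab oa.
have sAG : <[a]> \subset G by rewrite -mulAB mulG_subl.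
have nsAG : <[a]> <| G.
  by rewrite /normal sAG -mulAB mul_subG ?normG.
have iA : #|G : <[a]>| = n.
  by apply/eqP; rewrite -(eqn_pmul2l m_gt0) -oG -(Lagrange sAG) -orderE oa.
(* [b ^+ k] sends [a] to [a ^+ (r ^ k)], which is [a] exactly when [r ^ k] is 1 modulo [#[a] =
   m]. *)
have cab k : (b ^+ k \in 'C[a]) = (d %| k)%N.
  rewrite -(mult_order_dvd _ d_order) -oa -eq_expg_mod_order -ajbk expg1.
  by rewrite cent1C; apply/cent1P/eqP => [cab | /conjg_fixP/commgP //];
     rewrite conjgE cab mulKg.
have d_n : d %| n by rewrite -(mult_order_dvd _ d_order); apply/eqP.
have defCb : <[b]> :&: 'C(<[a]>) = <[b ^+ d]>.
  rewrite cent_cycle; apply/setP=> x; rewrite inE.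
  apply/andP/idP => [[/cycleP[k ->]] | /cycleP[k ->]].
    by rewrite cab => /dvdnP[q ->]; rewrite mulnC expgM mem_cycle.
  by rewrite -expgM mem_cycle cab dvdn_mulr.
(* Dedekind's modular law applies, as [<[a]>] centralizes itself. *)
have defC : 'C_G(<[a]>) = <[a]> * <[b ^+ d]>.
  by rewrite -defCb group_modl ?mulAB //; apply: cycle_abelian.
have cBA : <[b ^+ d]> \subset 'C(<[a]>) by rewrite -defCb subsetIr.
split=> //.
- by rewrite iA oa.
- by rewrite defC -cent_joinEr // joing_idl joing_idr.
- by rewrite defC abelianM !cycle_abelian.
rewrite defC coprime_cardMg -?orderE; last first.
  by rewrite orderXdiv ?ob // oa (coprime_dvdr (dvdn_div _)).
by rewrite orderXdiv ?ob // oa.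
Qed.

End ChermakDelgado.

Theorem theorem1 (m n r d : nat)
    (m_gt0 : (0 < m)%N) (n_gt0 : (0 < n)%N) (r_gt0 : (0 < r)%N)
    (co_mn : gcdn m n = 1%N) (co_mr : gcdn m (r - 1) = 1%N)
    (r_n : (r ^ n = 1 %[mod m])%N) (d_order : is_mult_order m r d)
    (gT : finGroupType) (G : {group gT}) (a b : gT) (G_ZM : is_ZM G a b m n r) :
  [/\ ((cd_max G)%:R = (m%:R ^+ 2 * n%:R ^+ 2) / d%:R ^+ 2 :> rat)%R,
      chain_of_length 0 (cd_lattice G)
    & cd_lattice G = [set <<[set a; (b ^+ d)%g]>>%G]].
Proof.
have [nsAG coA defC abC oC] :=
  ZM_structure m_gt0 n_gt0 (introT eqP co_mn) (introT eqP co_mr) r_n d_order G_ZM.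
have defL : cd_lattice G = [set <<[set a; (b ^+ d)%g]>>%G].
  rewrite (cd_lattice_cyclic_Hall nsAG) ?cycle_cyclic //.
  by congr [set _]; apply/val_inj.
split=> //; last first.
  rewrite /chain_of_length defL cards1; split=> // H K /set1P-> /set1P->.
  by left.
have [d_gt0 _ _] := d_order.
have d_n : d %| n by rewrite -(mult_order_dvd _ d_order); apply/eqP.
have d_neq0 : (d%:R != 0 :> rat)%R by rewrite Num.Theory.pnatr_eq0 -lt0n.
(* Only the [n] on the right becomes [n %/ d * d], so that [d%:R ^+ 2] cancels in [rat]. *)
rewrite (cd_max_cyclic_Hall nsAG) ?cycle_cyclic // oC -{2}(divnK d_n).
rewrite -GRing.exprMn -GRing.natrM mulnA (GRing.natrM _ _ d) GRing.exprMn.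
by rewrite GRing.mulfK ?GRing.expf_neq0 // GRing.natrX.
Qed.
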